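(* Let $B=(V,E)$ be a generalized Bratteli diagram with levels $V_n$, $n\ge 0$. Assume that (i) for every $n\ge 0$ there is a vertex $w_n\in V_n$ such that $E(w_n,v)\neq\emptyset$ for all $v\in V_{n+1}$; (ii) for every $n\geq 0$ and every vertex $w\in V_n$ there is a finite path from $w$ to $w_m$ for some $m>n$. Then $B$ is completely irreducible.
   Context: A generalized Bratteli diagram is a graded graph $B=(V,E)$ with $V=\bigsqcup_{n\ge 0}V_n$ and $E=\bigsqcup_{n\ge 0}E_n$ such that: (i) each level $V_n$ and each edge set $E_n$ is countably infinite; (ii) there are source and range maps $s,r$ on $E$ with $s(E_n)=V_n$ and $r(E_n)=V_{n+1}$; (iii) $|r^{-1}(v)|<\infty$ for every $v\in V\setminus V_0$. Multiple edges are allowed. All levels $V_n$ are identified with one and the same countably infinite set (such as $\mathbb{N}$, $\mathbb{N}_0=\mathbb{N}\cup\{0\}$ or $\mathbb{Z}$); this enumeration is part of the data. A finite path from $w\in V_n$ to $v\in V_m$ ($m>n$) is a sequence of edges $(e_n,\dots,e_{m-1})$, $e_k\in E_k$, with $s(e_n)=w$, $s(e_k)=r(e_{k-1})$, $r(e_{m-1})=v$. $E(w,v)$ denotes the set of all finite paths between $w$ and $v$; for $w\in V_n$, $v\in V_{n+1}$ it is the set of edges from $w$ to $v$. $B$ is irreducible if, with all levels identified with the set $V_0$, for any $i,j\in V_0$ and any $n\in\mathbb{N}_0$ there exists $m>n$ such that there is a finite path from $i\in V_n$ to $j\in V_m$. Two diagrams $B=(V,E)$ and $B'=(V',E')$ are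 isomorphic if there are bijections $g_n:V_n\to V_n'$ and $h_n:E_n\to E_n'$ for all $n\in\mathbb{N}_0$ with $s'\circ h_n=g_n\circ s$ and $r'\circ h_n=g_{n+1}\circ r$ on $E_n$. (The bijections $g_n$ are not required to be compatible with the identifications of different levels.) $B$ is completely irreducible if every generalized Bratteli diagram isomorphic to $B$ is irreducible. *)

(* Defs.v *)
From mathcomp Require Import all_boot.
From mathcomp Require Import boolp classical_sets functions cardinality.

Set Implicit Arguments.
Unset Strict Implicit.
Unset Printing Implicit Defensive.

Local Open Scope classical_set_scope.
Local Open Scope card_scope.

(* The disjoint unions of the levels and of the edge sets are given by the
   families [vertex] and [edge].  The set [index_set] with which all the levels are
   identified, and the identifications [vertex_of n], are part of the data;
   [index_set] is countably infinite because the levels are. *)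
Record gbd := Gbd {
  vertex : nat -> Type;
  edge : nat -> Type;
  index_set : Type;
  vertex_of : forall n, index_set -> vertex n;
  source : forall n, edge n -> vertex n;
  target : forall n, edge n -> vertex n.+1;
  vertex_of_bij : forall n, bijective (@vertex_of n);
  card_vertex : forall n, [set: vertex n] #= [set: nat];
  card_edge : forall n, [set: edge n] #= [set: nat];
  range_source : forall n, range (@source n) = [set: vertex n];
  range_target : forall n, range (@target n) = [set: vertex n.+1];
  finite_target : forall n (v : vertex n.+1), finite_set (@target n @^-1` [set v])
}.

Arguments vertex_of : clear implicits.

(* [finite_path w v] is the set E(w, v) of finite paths from [w] to [v].  Each path has
   at least one edge, so it is empty unless the level of [v] is strictly above
   that of [w]. *)
Inductive finite_path (B : gbd) n (w : vertex B n) : forall m, vertex B m -> Type :=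
| finite_path_edge (e : edge B n) : source e = w -> finite_path w (target e)
| finite_path_rcons m (v : vertex B m) (p : finite_path w v) (e : edge B m) :
    source e = v -> finite_path w (target e).

Definition irreducible (B : gbd) : Prop :=
  forall (i j : index_set B) (n : nat), exists2 m : nat, n < m &
    inhabited (finite_path (vertex_of B n i) (vertex_of B m j)).

(* The bijections [g n] need not be compatible with the identifications
   [vertex_of], and the index sets of the two diagrams may differ. *)
Definition isomorphic (B B' : gbd) : Prop :=
  exists (g : forall n, vertex B n -> vertex B' n)
         (h : forall n, edge B n -> edge B' n),
    [/\ forall n, bijective (g n),
        forall n, bijective (h n),
        forall n (e : edge B n), source (h n e) = g n (source e) &
        forall n (e : edge B n), target (h n e) = g n.+1 (target e)].

Definition completely_irreducible (B : gbd) : Prop :=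
  forall B' : gbd, isomorphic B B' -> irreducible B'.

(* Main.v *)
Require Import Defs.
From mathcomp Require Import all_boot.

(** Both hypotheses speak of paths only, not of the identifications of levels. Together they join
    any vertex of level [n] to every vertex of some level [m.+1], through [w m]. Given two vertices
    of an isomorphic diagram, pull them back to [B], concatenate ([finite_path_cat]) and push the
    path forward ([finite_path_map]). *)

(** Paths grow at their last edge, so the induction is on the second path. *)
Lemma finite_path_cat (B : gbd) n (x : vertex B n) m (y : vertex B m)
    k (z : vertex B k) :
  finite_path x y -> finite_path y z -> finite_path x z.
Proof.
move=> p; elim=> [e se|l v _ q e se]; first exact: (finite_path_rcons p se).
exact: (finite_path_rcons q se).
Qed.

Lemma finite_path_map (B B' : gbd) (g : forall n, vertex B n -> vertex B' n)
    (h : forall n, edge B n -> edge B' n)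
    (hs : forall n (e : edge B n), source (h n e) = g n (source e))
    (ht : forall n (e : edge B n), target (h n e) = g n.+1 (target e))
    n (x : vertex B n) m (y : vertex B m) :
  finite_path x y -> finite_path (g n x) (g m y).
Proof.
(* The constructors only build paths ending at a [target], so the endpoint is first put in the form
   [target (h _ e)]. *)
elim=> [e se|l v _ q e se]; rewrite -ht.
  by apply: finite_path_edge; rewrite hs se.
by apply: (finite_path_rcons q); rewrite hs se.
Qed.

Theorem proposition4p8 (B : gbd) (w : forall n : nat, vertex B n)
  (hyp_i : forall (n : nat) (v : vertex B n.+1), inhabited (finite_path (w n) v))
  (hyp_ii : forall (n : nat) (u : vertex B n),
     exists2 m : nat, n < m & inhabited (finite_path u (w m))) :
  completely_irreducible B.
Proof.
move=> B' [g [h [g_bij _ hs ht]]] i j n.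
have [f _ fK] := g_bij n.
have [m ltnm [p]] := hyp_ii n (f (vertex_of B' n i)).
(* The level [m] depends on [i] alone; as [w m] reaches all of level [m.+1], any [j] can be hit
   there. *)
have [f' _ fK'] := g_bij m.+1.
have [q] := hyp_i m (f' (vertex_of B' m.+1 j)).
exists m.+1; first exact: ltnW.
constructor; rewrite -[X in finite_path X]fK -[X in finite_path _ X]fK'.
exact: (finite_path_map _ _ _ _ hs ht _ _ _ _ (finite_path_cat _ _ _ _ _ _ _ p q)).
Qed.
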